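(* Let $(X,d)$ be a complete $b$-metric space with parameter $b\ge1$ and let $\{X; f_n, n=1,2,\dots,k\}$ be a generalized $F$-contractive iterated function system. Then the following hold: (a) The mapping $T:\mathcal{H}(X)\to\mathcal{H}(X)$ defined by $T(A)=\bigcup_{n=1}^{k}f_n(A)$ for all $A\in\mathcal{H}(X)$ is a Ciric type generalized $F$-Hutchinson operator, that is, $T$ is a Ciric type generalized $F$-contraction. (b) The operator $T$ has a unique fixed point $U\in\mathcal{H}(X)$, that is, $U=T(U)=\bigcup_{n=1}^{k}f_n(U)$. (c) For any initial set $A_0\in\mathcal{H}(X)$, the sequence of compact sets $\{A_0,T(A_0),T^2(A_0),\dots\}$ converges (with respect to $H$) to a fixed point of $T$.
   Context: A $b$-metric on a nonempty set $X$ with parameter $b\ge 1$ is a function $d:X\times X\to[0,\infty)$ such that for all $x,y,z\in X$: $d(x,y)=0$ if and only if $x=y$; $d(x,y)=d(y,x)$; and $d(x,y)\le b\,(d(x,z)+d(z,y))$. A sequence $\{x_n\}$ converges to $x$ if $d(x_n,x)\to 0$; it is Cauchy if for every $\varepsilon>0$ there is $n(\varepsilon)$ with $d(x_n,x_m)<\varepsilon$ for all $n,m\ge n(\varepsilon)$; $X$ is complete if every Cauchy sequence converges. A set $C\subseteq X$ is compact if every sequence in $C$ has a subsequence converging to a limit in $C$. $\mathcal{H}(X)$ is the set of all nonempty compact subsets of $X$. For $A,B\in\mathcal{H}(X)$, $H(A,B)=\max\{\sup_{b\in B}d(b,A),\ \sup_{a\in A}d(a,B)\}$, where $d(x,B)=\inf\{d(x,y):y\in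 B\}$. For $A\subseteq X$, $f(A)=\{f(x):x\in A\}$. $\digamma$ is the collection of all continuous mappings $F:(0,\infty)\to\mathbb{R}$ such that: (F1) $F$ is strictly increasing; (F2) for every sequence $\{\alpha_n\}$ of positive reals, $\lim_{n\to\infty}\alpha_n=0$ is equivalent to $\lim_{n\to\infty}F(\alpha_n)=-\infty$; (F3) there exists $h\in(0,1)$ with $\lim_{\alpha\to0^+}\alpha^hF(\alpha)=0$. $\Upsilon$ is the set of all mappings $\tau:(0,\infty)\to(0,\infty)$ such that $\liminf_{s\to t}\tau(s)>0$ for all $t\ge 0$. A mapping $f:X\to X$ is a generalized $F$-contraction if there exist $F\in\digamma$ and $\tau\in\Upsilon$ such that for all $x,y\in X$ with $d(fx,fy)>0$, $\tau(d(x,y))+F(d(fx,fy))\le F(d(x,y))$. A generalized $F$-contractive iterated function system $\{X;f_1,\dots,f_k\}$ consists of a complete $b$-metric space $X$ and finitely many generalized $F$-contractions $f_n:X\to X$, $n=1,\dots,k$. A mapping $T:\mathcal{H}(X)\to\mathcal{H}(X)$ is a Ciric type generalized $F$-contraction if there exist $F\in\digamma$ and $\tau\in\Upsilon$ such that for all $A,B\in\mathcal{H}(X)$ with $H(T(A),T(B))\ne0$, $$\tau(M_T(A,B))+F(H(T(A),T(B)))\le F(M_T(A,B)),$$ where $$M_T(A,B)=\max\Big\{H(A,B),\,H(A,T(A)),\,H(B,T(B)),\,\tfrac{H(A,T(B))+H(B,T(A))}{2b},\,H(T^2(A),T(A)),\,H(T^2(A),B),\,H(T^2(A),T(B))\Big\}.$$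 An operator of the form $T(A)=\bigcup_n f_n(A)$ with this property is called a Ciric type generalized $F$-Hutchinson operator. *)

(* Defs.v *)
From mathcomp Require Import all_boot all_order all_algebra.
From mathcomp Require Import all_classical all_reals all_analysis.

Set Implicit Arguments.
Unset Strict Implicit.
Unset Printing Implicit Defensive.

Import Order.TTheory GRing.Theory Num.Theory.
Import numFieldNormedType.Exports.

Local Open Scope classical_set_scope.
Local Open Scope ring_scope.

Section BMetric.
Context {R : realType} {X : Type}.
Implicit Types (d : X -> X -> R) (A B C : set X) (u : nat -> X) (x y z : X).

Record is_bmetric (b : R) d : Prop := IsBMetric {
  bmetric_nonempty : [set: X] !=set0;
  bmetric_param_ge1 : 1 <= b;
  bmetric_ge0 : forall x y, 0 <= d x y;
  bmetric_eq0 : forall x y, d x y = 0 <-> x = y;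
  bmetric_sym : forall x y, d x y = d y x;
  bmetric_triangle : forall x y z, d x y <= b * (d x z + d z y) }.

Definition bconverges d u x : Prop := (fun n => d (u n) x) @ \oo --> (0 : R).

Definition bcauchy d u : Prop :=
  forall e : R, 0 < e ->
    exists N, forall n m, (N <= n)%N -> (N <= m)%N -> d (u n) (u m) < e.

Definition bcomplete d : Prop :=
  forall u, bcauchy d u -> exists x, bconverges d u x.

Definition bcompact d C : Prop :=
  forall u, (forall n, C (u n)) ->
    exists phi : nat -> nat, {homo phi : m n / (m < n)%N} /\
      exists x, C x /\ bconverges d (u \o phi) x.

Record hyperspace d := Hyperspace {
  hyperset :> set X;
  hyperset_neq0 : hyperset !=set0;
  hyperset_compact : bcompact d hyperset }.

Definition set_dist d x B : R := inf [set d x y | y in B].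

(* In a b-metric space compact sets are bounded, so on nonempty compact sets
   the real-valued [sup] and [inf] below are genuine suprema and infima. *)
Definition hausdorff d A B : R :=
  Num.max (sup [set set_dist d y A | y in B])
          (sup [set set_dist d x B | x in A]).

End BMetric.

Section FContraction.
Context {R : realType}.

(* Functions on (0, +oo) are represented by total functions on R; every
   condition only involves their values at positive arguments. *)
Record digamma_class (F : R -> R) : Prop := DigammaClass {
  digamma_continuous : {within `]0, +oo[%classic, continuous F};
  digamma_increasing : forall s t : R, 0 < s -> s < t -> F s < F t;
  digamma_lim : forall a : nat -> R, (forall n, 0 < a n) ->
    (a @ \oo --> (0 : R)) <-> ((fun n => F (a n)) @ \oo --> -oo);
  digamma_power : exists h : R, 0 < h < 1 /\
    (fun a => a `^ h * F a) @ (0 : R)^'+ --> (0 : R) }.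

Record upsilon_class (tau : R -> R) : Prop := UpsilonClass {
  upsilon_gt0 : forall s : R, 0 < s -> 0 < tau s;
  upsilon_liminf : forall t : R, 0 <= t ->
    (0 < limf_einf (fun s => (tau s)%:E)
           (within [set s : R | (0 < s)%R] (dnbhs t)))%E }.

Definition generalized_F_contraction {X : Type} (d : X -> X -> R) (f : X -> X)
    : Prop :=
  exists F tau, [/\ digamma_class F, upsilon_class tau &
    forall x y, 0 < d (f x) (f y) ->
      tau (d x y) + F (d (f x) (f y)) <= F (d x y)].

Record generalized_F_contractive_IFS {X : Type} (b : R) (d : X -> X -> R)
    (k : nat) (f : 'I_k -> X -> X) : Prop := GeneralizedFContractiveIFS {
  IFS_bmetric : is_bmetric b d;
  IFS_complete : bcomplete d;
  IFS_size_gt0 : (0 < k)%N;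
  IFS_contraction : forall i, generalized_F_contraction d (f i) }.

Section Ciric.
Context {X : Type} (b : R) (d : X -> X -> R).
Implicit Types (T : hyperspace d -> hyperspace d) (A B : hyperspace d).

Local Notation H := (hausdorff d).

Definition ciric_M T A B : R :=
  Num.max (H A B) (Num.max (H A (T A)) (Num.max (H B (T B))
    (Num.max ((H A (T B) + H B (T A)) / (2 * b))
      (Num.max (H (T (T A)) (T A)) (Num.max (H (T (T A)) B)
        (H (T (T A)) (T B))))))).

Definition ciric_generalized_F_contraction T : Prop :=
  exists F tau, [/\ digamma_class F, upsilon_class tau &
    forall A B, H (T A) (T B) != 0 ->
      tau (ciric_M T A B) + F (H (T A) (T B)) <= F (ciric_M T A B)].

Definition is_union_operator (k : nat) (f : 'I_k -> X -> X) T : Prop :=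
  forall A, T A = \bigcup_(i in [set: 'I_k]) (f i @` A) :> set X.

Definition ciric_generalized_F_hutchinson (k : nat) (f : 'I_k -> X -> X) T
    : Prop :=
  is_union_operator f T /\ ciric_generalized_F_contraction T.

End Ciric.
End FContraction.

(* Main.v *)
Require Import Defs.
From mathcomp Require Import all_boot all_order all_algebra.
From mathcomp Require Import all_classical all_reals all_analysis.
From mathcomp Require Import ring lra zify.
Import Order.TTheory GRing.Theory Num.Theory.
Import numFieldNormedType.Exports.
Local Open Scope classical_set_scope.
Local Open Scope ring_scope.

(** The maps [f i] come with different functions [F i] and [tau i]. Since each
    [F i] is increasing and each [f i] shrinks distances, the sum [G] of the
    [F i] is an admissible function common to all of them ([digamma_sum],
    [F_gap_sum]). The functions [tau i] only matter through the following
    local condition ([F_gap]): around every [t0 >= 0] there is a positive lower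
    bound for the gap [F t - F h] between a distance [t] and the distance [h] of
    the images. An inequality [tau t + F h <= F t] with [tau] in the class
    Upsilon gives such gaps ([upsilon_F_gap]), and conversely the infimum of the
    gaps at [t] is a suitable [tau] ([F_gap_upsilon]).

    Gaps pass from points to compact sets. Let [h = H(TA, TB) > 0] and
    [t >= H(A, B)]. For every small [e > 0] there are points [x], [y] and an
    index [i] with [d x y < t + e] and [h - e < d (f i x) (f i y)]
    ([hutchinson_relax]); no more can be said, because a b-metric need not be
    continuous and the infimum in a distance to a compact set need not be
    attained. A gap for the pairs of points survives this relaxation
    ([F_gap_relax]), by continuity and monotonicity of [G]. With
    [t = M_T(A, B) >= H(A, B)] this is the Ciric type contraction property of
    part (a); the other six terms of the maximum play no part.

    With [t] just above [H(A, B)] it also shows that [T] is a uniform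
    contraction for [H]: [H(A, B) < t + e] implies [H(TA, TB) <= t - e] for some
    [e > 0] depending on [t > 0] only ([F_gap_uniform_contraction]). For the
    iterates this gives uniform convergence to 0 of the distances on pairs at
    bounded distance, and an orbit whose short steps have become small is
    trapped in a small ball by an iterate that shrinks this ball by a factor
    [2b]; hence in a complete b-metric space a uniform contraction has a fixed
    point that attracts all orbits ([uniform_contraction_fixed]). It remains to
    see that the nonempty compact sets form a complete b-metric space for [H]
    ([hausdorff_bmetric], [hausdorff_complete]): the limit of a Cauchy sequence
    of compact sets is the set of its cluster points, whose compactness is a
    diagonal argument ([asymp_compact_subseq]). *)

(** * Sequences in b-metric spaces *)

Lemma natSinv_lt {R : realType} {e : R} : 0 < e ->
  exists N, forall n, (N <= n)%N -> n.+1%:R^-1 < e.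
Proof.
by move=> e0; have [N _ uN] := near_infty_natSinv_lt (PosNum e0); exists N.
Qed.

Section BMetricSpaces.
Set Implicit Arguments.
Unset Strict Implicit.
Context {R : realType} {X : Type} {b : R} {d : X -> X -> R}.
Context (bm : is_bmetric b d).

Let b_ge1 : 1 <= b := bmetric_param_ge1 bm.
Let b_gt0 : 0 < b. Proof. exact: lt_le_trans ltr01 b_ge1. Qed.
Let d_ge0 := bmetric_ge0 bm.

Lemma bmetric_xx x : d x x = 0.
Proof. exact/(bmetric_eq0 bm). Qed.

Lemma bmetric_gt0 x y : x <> y -> 0 < d x y.
Proof.
by move=> xy; rewrite lt_neqAle d_ge0 andbT eq_sym; apply/eqP => /(bmetric_eq0 bm).
Qed.

Lemma bmetric_small_eq x y : (forall e, 0 < e -> d x y <= e) -> x = y.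
Proof.
move=> xy; apply/(bmetric_eq0 bm)/eqP; rewrite eq_le d_ge0 andbT.
by apply/ler_addgt0Pr => e e0; rewrite add0r xy.
Qed.

Lemma bmetric_triangle_lt x y z (r s : R) :
  d x z < r -> d z y < s -> d x y < b * (r + s).
Proof.
move=> xz zy; apply: le_lt_trans (bmetric_triangle bm x y z) _.
by rewrite ltr_pM2l // ltrD.
Qed.

Lemma bconvergesP u x :
  bconverges d u x <->
  forall e, 0 < e -> exists N, forall n, (N <= n)%N -> d (u n) x < e.
Proof.
rewrite /bconverges; split.
- move=> /cvgrPdist_lt ux e /ux [N _ uN]; exists N => n Nn.
  by have := uN n Nn; rewrite /= sub0r normrN ger0_norm.
- move=> ux; apply/cvgrPdist_lt => e /ux [N uN]; exists N => // n /= Nn.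
  by rewrite sub0r normrN ger0_norm //; exact: uN.
Qed.

Lemma bconverges_unique u x y : bconverges d u x -> bconverges d u y -> x = y.
Proof.
move=> /bconvergesP ux /bconvergesP uy; apply: bmetric_small_eq => e e0.
have e'0 : 0 < e / (2 * b) by rewrite divr_gt0 // mulr_gt0.
have [N uN] := ux _ e'0; have [M uM] := uy _ e'0.
have xu := uN (maxn N M) (leq_maxl _ _); rewrite (bmetric_sym bm) in xu.
have := bmetric_triangle_lt xu (uM (maxn N M) (leq_maxr _ _)).
suff -> : b * (e / (2 * b) + e / (2 * b)) = e by exact: ltW.
by field; rewrite gt_eqF.
Qed.

Lemma subseq_ge (phi : nat -> nat) :
  {homo phi : m n / (m < n)%N} -> forall n, (n <= phi n)%N.
Proof. by move=> hphi; elim=> // n /leq_ltn_trans; apply; exact: hphi. Qed.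

Lemma bconverges_subseq u x (phi : nat -> nat) :
  {homo phi : m n / (m < n)%N} -> bconverges d u x -> bconverges d (u \o phi) x.
Proof.
move=> hphi /bconvergesP ux; apply/bconvergesP => e /ux [N uN].
by exists N => n Nn; apply: uN; exact: leq_trans Nn (subseq_ge hphi n).
Qed.

(** A compact set contains every point that it approaches. *)
Lemma bcompact_closed C x : bcompact d C ->
  (forall e, 0 < e -> exists2 y, C y & d x y < e) -> C x.
Proof.
move=> cC xC.
have /choice[u uP] (n : nat) : exists y, C y /\ d x y < n.+1%:R^-1.
  by have [|y Cy xy] := xC n.+1%:R^-1; [rewrite invr_gt0|exists y].
have [|phi [hphi [y [Cy uy]]]] := cC u; first by move=> n; have [] := uP n.
suff -> : x = y by [].
apply: bconverges_unique uy; apply: bconverges_subseq hphi _.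
apply/bconvergesP => e /natSinv_lt[N Ne]; exists N => n Nn.
by rewrite (bmetric_sym bm); have [_ /lt_trans] := uP n; apply; exact: Ne.
Qed.

Lemma bcompact_bounded C x : bcompact d C -> exists D, forall y, C y -> d x y <= D.
Proof.
move=> cC; apply: contrapT => unb.
have /choice[u uP] (n : nat) : exists y, C y /\ n%:R < d x y.
  apply: contrapT => nu; apply: unb; exists n%:R => y Cy; rewrite leNgt.
  by apply/negP => ny; apply: nu; exists y.
have [|phi [hphi [y [_ /bconvergesP uy]]]] := cC u; first by move=> n; have [] := uP n.
have [N uN] := uy 1 ltr01.
have D0 : 0 <= b * (d x y + 1) by rewrite mulr_ge0 ?addr_ge0 // ltW.
pose M := maxn N (Num.bound (b * (d x y + 1))).
have /ltW := uN M (leq_maxl _ _); rewrite (bmetric_sym bm) => yu.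
have [_ +] := uP (phi M); apply/negP; rewrite -leNgt.
apply: le_trans (bmetric_triangle bm _ _ y) _.
apply: (@le_trans _ _ (b * (d x y + 1))); first by rewrite ler_pM2l // lerD2l.
apply: le_trans (ltW (archi_boundP D0)) _; rewrite ler_nat.
exact: leq_trans (leq_maxr _ _) (subseq_ge hphi M).
Qed.

(** A sequence is relatively compact as soon as, at every scale [e], its terms
    are eventually [e]-close to some compact set. *)
Definition asymp_compact (u : nat -> X) :=
  forall e : R, 0 < e -> exists2 C, bcompact d C &
    exists N, forall n, (N <= n)%N -> exists2 c, C c & d (u n) c < e.

(** Any subsequence can be thinned out to one of diameter less than [e]. *)
Lemma asymp_compact_small u (psi : nat -> nat) (e : R) :
  asymp_compact u -> {homo psi : m n / (m < n)%N} -> 0 < e ->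
  exists2 theta : nat -> nat, {homo theta : m n / (m < n)%N} &
    forall m n, d (u (psi (theta m))) (u (psi (theta n))) < e.
Proof.
move=> au hpsi e0.
(* The triangle inequality is used twice, so that the diameter is at most
   [b (2 b r + 2 b r) = 4 b^2 r]. *)
pose r := e / (2 * (2 * b) * b).
have r0 : 0 < r by rewrite divr_gt0 // !mulr_gt0.
have [C cC [N uN]] := au r r0.
have /choice[c cP] (n : nat) : exists c, C c /\ d (u (psi (N + n)%N)) c < r.
  have [|c Cc uc] := uN (psi (N + n)%N); last by exists c.
  exact: leq_trans (leq_addr n N) (subseq_ge hpsi _).
have [|phi [hphi [y [Cy /bconvergesP cy]]]] := cC c; first by move=> n; have [] := cP n.
have [M cM] := cy r r0.
exists (fun n => N + phi (M + n))%N.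
  by move=> m n mn; rewrite ltn_add2l hphi // ltn_add2l.
move=> m n.
have uy k : d (u (psi (N + phi (M + k))%N)) y < b * (r + r).
  apply: bmetric_triangle_lt (cP _).2 _; exact: cM (leq_addr _ _).
have yu := uy n; rewrite (bmetric_sym bm) in yu.
apply: lt_le_trans (bmetric_triangle_lt (uy m) yu) _.
rewrite le_eqVlt; apply/orP; left; apply/eqP.
by rewrite /r; field; rewrite gt_eqF.
Qed.

(** In a complete space such a sequence has a convergent subsequence: the
    diagonal of successive subsequences of smaller and smaller diameter is
    Cauchy. *)
Lemma asymp_compact_subseq u : bcomplete d -> asymp_compact u ->
  exists phi : nat -> nat, {homo phi : m n / (m < n)%N} /\
    exists x, bconverges d (u \o phi) x.
Proof.
move=> cd au.
(* [step (j, psi)] thins out the subsequence [psi] to one of diameter less than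
   [1 / (j + 1)]; it carries no information when [psi] is not increasing. *)
pose good (p : nat * (nat -> nat)) (theta : nat -> nat) :=
  {homo p.2 : m n / (m < n)%N} -> {homo theta : m n / (m < n)%N} /\
    forall m n, d (u (p.2 (theta m))) (u (p.2 (theta n))) < p.1.+1%:R^-1.
have /choice[step stepP] p : exists theta, good p theta.
  have [hp|nhp] := pselect {homo p.2 : m n / (m < n)%N}; last by exists id.
  have p0 : (0 : R) < p.1.+1%:R^-1 by rewrite invr_gt0.
  by have [theta ht small] := asymp_compact_small au hp p0; exists theta.
pose psi := fix psi j := if j is j'.+1 then psi j' \o step (j', psi j') else id.
have hpsi j : {homo psi j : m n / (m < n)%N}.
  by elim: j => // j IH m n mn; apply/IH/(stepP (j, psi j) IH).1.
have range j l n : exists m, psi (j + l)%N n = psi j m.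
  elim: l n => [|l IH] n; first by exists n; rewrite addn0.
  by rewrite addnS /=; exact: IH.
have diam j m n : d (u (psi j.+1 m)) (u (psi j.+1 n)) < j.+1%:R^-1.
  exact: (stepP (j, psi j) (hpsi j)).2.
exists (fun n => psi n n); split.
  apply: homo_ltn; first exact: ltn_trans.
  move=> n /=; apply/hpsi; apply: leq_trans (ltnSn n) _.
  exact/subseq_ge/(stepP (n, psi n) (hpsi n)).1.
apply: cd => e /natSinv_lt[N Ne]; exists N.+1 => m n Nm Nn /=.
have [m' em] := range N.+1 (m - N.+1)%N m; rewrite subnKC // in em.
have [n' en] := range N.+1 (n - N.+1)%N n; rewrite subnKC // in en.
by rewrite em en; apply: lt_trans (diam N _ _) (Ne N _).
Qed.

End BMetricSpaces.

(** * The Hausdorff distance on nonempty compact sets *)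

Section Hyperspaces.
Set Implicit Arguments.
Unset Strict Implicit.
Context {R : realType} {X : Type} {b : R} {d : X -> X -> R}.
Context (bm : is_bmetric b d).

Let b_ge1 : 1 <= b := bmetric_param_ge1 bm.
Let b_gt0 : 0 < b. Proof. exact: lt_le_trans ltr01 b_ge1. Qed.
Let d_ge0 := bmetric_ge0 bm.



Lemma set_dist_ge0 x (B : set X) : B !=set0 -> 0 <= set_dist d x B.
Proof.
by move=> [y By]; apply: lb_le_inf => [|_ [z _ <-]//]; exists (d x y), y.
Qed.

Lemma set_dist_le x y (B : set X) : B y -> set_dist d x B <= d x y.
Proof. by move=> By; apply: ge_inf; [exists 0 => _ [z _ <-]|exists y]. Qed.

Lemma le_hausdorff_l (A B : set X) x : bcompact d A -> B !=set0 -> A x ->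
  set_dist d x B <= hausdorff d A B.
Proof.
move=> cA [y By] Ax; rewrite /hausdorff le_max; apply/orP; right.
apply: ub_le_sup; last by exists x.
have [D DP] := bcompact_bounded bm y cA; exists D => _ [z Az <-].
by apply: le_trans (set_dist_le z By) _; rewrite (bmetric_sym bm) DP.
Qed.

Lemma hausdorffC (A B : set X) : hausdorff d A B = hausdorff d B A.
Proof. by rewrite /hausdorff maxC. Qed.

(** The next two lemmas are the interface to [hausdorff]. The bound in the first
    is strict because distances to compact sets need not be attained. *)
Lemma hausdorff_lt (A B : set X) r x : bcompact d A -> B !=set0 ->
  hausdorff d A B < r -> A x -> exists2 y, B y & d x y < r.
Proof.
move=> cA B0 Hr Ax; have := le_lt_trans (le_hausdorff_l cA B0 Ax) Hr.
move=> /inf_lt; case; first by case: B0 => y By; exists (d x y), y.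
by move=> _ [y By <-] xy; exists y.
Qed.

Lemma hausdorff_le (A B : set X) r : A !=set0 -> B !=set0 ->
  (forall x, A x -> exists2 y, B y & d x y <= r) ->
  (forall y, B y -> exists2 x, A x & d y x <= r) -> hausdorff d A B <= r.
Proof.
move=> [x Ax] [y By] AB BA; rewrite /hausdorff ge_max; apply/andP; split.
- apply: ge_sup => [|_ [z Bz <-]]; first by exists (set_dist d y A), y.
  by have [w Aw zw] := BA z Bz; exact: le_trans (set_dist_le z Aw) zw.
- apply: ge_sup => [|_ [z Az <-]]; first by exists (set_dist d x B), x.
  by have [w Bw zw] := AB z Az; exact: le_trans (set_dist_le z Bw) zw.
Qed.

(** Elements of the hyperspace are determined by their underlying sets. *)
Lemma hyperset_inj (A B : hyperspace d) : A = B :> set X -> A = B.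
Proof.
case: A B => [A A0 cA] [B B0 cB] /= eAB; subst B.
by congr Hyperspace; exact: Prop_irrelevance.
Qed.

Lemma bcompact1 x : bcompact d [set x].
Proof.
move=> u ux; exists id; split=> //; exists x; split=> //; apply/(bconvergesP bm) => e e0.
by exists 0%N => n _ /=; rewrite (ux n) (bmetric_xx bm).
Qed.

Lemma hausdorff_eq0_subset (A B : hyperspace d) : hausdorff d A B = 0 -> A `<=` B.
Proof.
move=> AB x Ax; apply: (bcompact_closed bm (@hyperset_compact _ _ _ B)) => e e0.
by apply: hausdorff_lt Ax; [exact: hyperset_compact|exact: hyperset_neq0|rewrite AB].
Qed.

Lemma hausdorff_bmetric : is_bmetric b (fun A B : hyperspace d => hausdorff d A B).
Proof.
have hn0 := @hyperset_neq0 _ _ d; have hc := @hyperset_compact _ _ d.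
split=> //.
- have [x _] := bmetric_nonempty bm.
  by exists (Hyperspace (ex_intro _ x (erefl x) : [set x] !=set0) (@bcompact1 x)).
- move=> A B; have [x Ax] := hn0 A.
  exact: le_trans (set_dist_ge0 x (hn0 B)) (le_hausdorff_l (hc A) (hn0 B) Ax).
- move=> A B; split=> [AB|->].
    apply: hyperset_inj; apply/seteqP; split; apply: hausdorff_eq0_subset => //.
    by rewrite hausdorffC.
  apply/eqP; rewrite eq_le; apply/andP; split.
    by apply: hausdorff_le => // x Bx; exists x => //; rewrite (bmetric_xx bm).
  have [x Bx] := hn0 B.
  exact: le_trans (set_dist_ge0 x (hn0 B)) (le_hausdorff_l (hc B) (hn0 B) Bx).
- by move=> A B; exact: hausdorffC.
- move=> A B C; apply/ler_addgt0Pr => e e0.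
  have e'0 : 0 < e / (2 * b) by rewrite divr_gt0 // mulr_gt0.
  have -> : b * (hausdorff d A C + hausdorff d C B) + e =
      b * ((hausdorff d A C + e / (2 * b)) + (hausdorff d C B + e / (2 * b))).
    by field; rewrite gt_eqF.
  have lt_e' (s : R) : s < s + e / (2 * b) by rewrite ltrDl.
  apply: hausdorff_le => // x xP.
  + have [z Cz xz] := hausdorff_lt (hc A) (hn0 C) (lt_e' _) xP.
    have [y By zy] := hausdorff_lt (hc C) (hn0 B) (lt_e' _) Cz.
    by exists y => //; exact: ltW (bmetric_triangle_lt bm xz zy).
  + rewrite (hausdorffC A C) (hausdorffC C B) [X in b * X]addrC.
    have [z Cz xz] := hausdorff_lt (hc B) (hn0 C) (lt_e' _) xP.
    have [y By zy] := hausdorff_lt (hc C) (hn0 A) (lt_e' _) Cz.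
    by exists y => //; exact: ltW (bmetric_triangle_lt bm xz zy).
Qed.


(** The points that are approached by points of [A n] for arbitrarily large [n]. *)
Definition cluster_set (A : nat -> hyperspace d) : set X :=
  [set x | forall e, 0 < e -> forall N, exists2 n, (N <= n)%N &
    exists2 a, hyperset (A n) a & d a x < e].

(** Along a Cauchy sequence of compact sets, any selection of points from later
    and later sets has a subsequence that converges to a cluster point,
    because all sets from some index on are close to the set at that index, which
    is compact. *)
Lemma cluster_set_subseq (A : nat -> hyperspace d) (nu : nat -> nat) u :
  bcomplete d -> bcauchy (fun A B : hyperspace d => hausdorff d A B) A ->
  (forall n, (n <= nu n)%N) -> (forall n, hyperset (A (nu n)) (u n)) ->
  exists phi : nat -> nat, {homo phi : m n / (m < n)%N} /\
    exists x, cluster_set A x /\ bconverges d (u \o phi) x.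
Proof.
move=> cd cA hnu Au.
have [|phi [hphi [x ux]]] := asymp_compact_subseq bm (u := u) cd.
  move=> e /cA[N AN]; exists (A N); first exact: hyperset_compact.
  exists N => n Nn; apply: hausdorff_lt (Au n).
  - exact: hyperset_compact.
  - exact: hyperset_neq0.
  - by apply: AN => //; exact: leq_trans Nn (hnu n).
exists phi; split=> //; exists x; split=> // e e0 N.
move: ux => /(bconvergesP bm)/(_ e e0)[M uM]; pose n := maxn N M.
exists (nu (phi n)); last by exists (u (phi n)) => //; exact/uM/leq_maxr.
exact: leq_trans (leq_trans (leq_maxl N M) (subseq_ge hphi n)) (hnu _).
Qed.

Theorem hausdorff_complete :
  bcomplete d -> bcomplete (fun A B : hyperspace d => hausdorff d A B).
Proof.
move=> cd A cA; pose U := cluster_set A.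
have hn0 := @hyperset_neq0 _ _ d; have hc := @hyperset_compact _ _ d.
have U0 : U !=set0.
  have /choice[u uA] n : exists x, hyperset (A n) x := hn0 (A n).
  have [phi [_ [x [Ux _]]]] := cluster_set_subseq (u := u) (nu := id) cd cA
    (fun=> leqnn _) uA.
  by exists x.
have cU : bcompact d U.
  move=> x Ux.
  have /choice[nu_u nu_uP] (n : nat) : exists p : nat * X,
      [/\ (n <= p.1)%N, hyperset (A p.1) p.2 & d p.2 (x n) < n.+1%:R^-1].
    have e0 : (0 : R) < n.+1%:R^-1 by rewrite invr_gt0.
    by have [m nm [a Aa ax]] := Ux n _ e0 n; exists (m, a).
  have [||phi [hphi [y [Uy uy]]]] := cluster_set_subseq (nu := fst \o nu_u)
    (u := snd \o nu_u) cd cA; try by move=> n; have [] := nu_uP n.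
  exists phi; split=> //; exists y; split=> //; apply/(bconvergesP bm) => e e0.
  have e'0 : 0 < e / (2 * b) by rewrite divr_gt0 // mulr_gt0.
  move: uy => /(bconvergesP bm)/(_ _ e'0)[M uM]; have [N Ne] := natSinv_lt e'0.
  exists (maxn M N) => n; rewrite geq_max => /andP[Mn Nn].
  have -> : e = b * (e / (2 * b) + e / (2 * b)) by field; rewrite gt_eqF.
  apply: (bmetric_triangle_lt bm _ (uM n Mn)); rewrite (bmetric_sym bm).
  have [_ _ ux] := nu_uP (phi n); apply: lt_trans ux (Ne _ _).
  exact: leq_trans Nn (subseq_ge hphi n).
exists (Hyperspace U0 cU); apply/(bconvergesP hausdorff_bmetric) => e e0.
pose r := e / (4 * b); have r0 : 0 < r by rewrite divr_gt0 // mulr_gt0.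
have re : b * (r + r) < e.
  by have -> : b * (r + r) = e / 2 by [rewrite /r; field; rewrite gt_eqF]; lra.
have [N AN] := cA r r0; exists N => n Nn; apply: le_lt_trans re.
apply: hausdorff_le => // x xP.
- have /choice[u uP] (m : nat) : exists y, hyperset (A (n + m)%N) y /\ d x y < r.
    have nm : hausdorff d (A n) (A (n + m)%N) < r.
      by apply: AN => //; exact: leq_trans Nn (leq_addr _ _).
    by have [y Ay xy] := hausdorff_lt (hc _) (hn0 _) nm xP; exists y.
  have [|m|phi [_ [y [Uy uy]]]] := cluster_set_subseq (nu := addn n) (u := u) cd cA.
  + by move=> m; exact: leq_addl.
  + by have [] := uP m.
  move: uy => /(bconvergesP bm)/(_ r r0)[M uM]; exists y => //.
  exact: ltW (bmetric_triangle_lt bm (uP (phi M)).2 (uM M (leqnn M))).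
- have [m Nm [y Ay yx]] := xP r r0 N; rewrite (bmetric_sym bm) in yx.
  have [z Az yz] := hausdorff_lt (hc _) (hn0 _) (AN m n Nm Nn) Ay.
  by exists z => //; exact: ltW (bmetric_triangle_lt bm yx yz).
Qed.

End Hyperspaces.

(** * Fixed points of uniform contractions *)

(** Pairs at distance at most [t], or slightly more, are mapped to pairs at
    distance less than [t], uniformly. This holds for contractions governed by a
    nondecreasing right-continuous comparison function below the identity. *)
Definition uniform_contraction {R : realType} {Y : Type} (d : Y -> Y -> R)
    (f : Y -> Y) : Prop :=
  forall t : R, 0 < t -> exists2 e : R, 0 < e &
    forall x y, d x y < t + e -> d (f x) (f y) <= t - e.

Section FixedPoint.
Set Implicit Arguments.
Unset Strict Implicit.
Context {R : realType} {X : Type} {b : R} {d : X -> X -> R}.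
Context (bm : is_bmetric b d).
Context (f : X -> X) (fc : uniform_contraction d f).

Let b_ge1 : 1 <= b := bmetric_param_ge1 bm.
Let b_gt0 : 0 < b. Proof. exact: lt_le_trans ltr01 b_ge1. Qed.
Let d_ge0 := bmetric_ge0 bm.

Lemma uniform_contraction_le x y : d (f x) (f y) <= d x y.
Proof.
have [<-|xy] := pselect (x = y); first by rewrite !(bmetric_xx bm).
have [e e0 fe] := fc (bmetric_gt0 bm xy).
by apply: le_trans (fe x y _) _; rewrite ?ltrDl // lerBlDr lerDl ltW.
Qed.

Lemma uniform_contraction_iter_le n x y : d (iter n f x) (iter n f y) <= d x y.
Proof. by elim: n => //= n; apply: le_trans; exact: uniform_contraction_le. Qed.

(** The infimum of the bounds that the iterates eventually satisfy is 0: if it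
    were [t > 0], one more iteration would improve a bound close to [t] to
    [t - e]. *)
Lemma uniform_contraction_iter_small D e : 0 < e ->
  exists N, forall n x y, (N <= n)%N -> d x y <= D -> d (iter n f x) (iter n f y) < e.
Proof.
move=> e0; have [D0|D0] := ltP D 0.
  exists 0%N => n x y _ xy.
  by have := le_lt_trans (le_trans (d_ge0 x y) xy) D0; rewrite ltxx.
pose S := [set s : R | 0 <= s /\ exists N, forall x y, d x y <= D ->
  d (iter N f x) (iter N f y) <= s].
have SD : S D by split=> //; exists 0%N.
have lS : has_lbound S by exists 0 => s [].
have S0 : S !=set0 by exists D.
suff /(inf_lt S0)[s [_ [N Ns]] se] : inf S < e.
  exists N => n x y Nn /Ns xy; rewrite -(subnK Nn) !iterD.
  exact: le_lt_trans (uniform_contraction_iter_le _ _ _) (le_lt_trans xy se).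
apply: le_lt_trans e0; rewrite leNgt; apply/negP => i0.
have [r r0 fr] := fc i0.
have /(inf_lt S0)[s [_ [N Ns]] sr] : inf S < inf S + r by rewrite ltrDl.
have Sr : S (Num.max 0 (inf S - r)).
  split; first by rewrite le_max lexx.
  exists N.+1 => x y xy; rewrite le_max; apply/orP; right.
  exact: fr (le_lt_trans (Ns x y xy) sr).
have := ge_inf lS Sr; rewrite le_max !leNgt i0 /= => /negP; apply.
by rewrite ltrBlDr ltrDl.
Qed.

(** Let [f^N] map pairs at distance at most [e] to pairs at distance less than
    [r = e / 2b]. As soon as the distances of the orbit point [f^n y] to the next
    [N] ones are less than [r], the orbit stays [e]-close to [f^n y], by
    induction: [f^(n+m) y] is the image under [f^N] of a point [e]-close to
    [f^n y], hence [r]-close to [f^(n+N) y], which is [r]-close to [f^n y]. *)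
Lemma uniform_contraction_cauchy y : bcauchy d (fun n => iter n f y).
Proof.
suff trapped e : 0 < e ->
    exists n0, forall n m, (n0 <= n)%N -> d (iter n f y) (iter (n + m) f y) <= e.
  move=> e e0; have e20 : 0 < e / 2 by rewrite divr_gt0.
  have [N NP] := trapped _ e20; exists N => n m Nn Nm.
  wlog nm : n m Nn Nm / (n <= m)%N => [hwlog|].
    by have [/hwlog->//|/ltnW/hwlog] := leqP n m; rewrite (bmetric_sym bm); apply.
  by rewrite -(subnKC nm); apply: le_lt_trans (NP n _ Nn) _; lra.
move=> e0; pose r := e / (2 * b).
have r0 : 0 < r by rewrite divr_gt0 // mulr_gt0.
have rE : b * (r + r) = e by rewrite /r; field; rewrite gt_eqF.
have rle : r <= e.
  by rewrite -rE; apply: (@le_trans _ _ (r + r));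
    rewrite ?ler_peMl ?lerDl // ltW // addr_gt0.
have [N' N'P] := uniform_contraction_iter_small e r0.
(* The number of steps has to be positive for the induction on [m] below. *)
pose N := N'.+1.
pose D := \sum_(m < N.+1) d y (iter m f y).
have [n0 n0P] := uniform_contraction_iter_small D r0.
have short n m : (n0 <= n)%N -> (m <= N)%N -> d (iter n f y) (iter (n + m) f y) < r.
  move=> n0n mN; rewrite iterD; apply: n0P => //.
  by rewrite /D (bigD1 (Ordinal (mN : m < N.+1)%N)) //= lerDl sumr_ge0.
exists n0 => n m n0n; elim/ltn_ind: m => m IH.
have [/(short n m n0n)/ltW/le_trans->//|Nm] := leqP m N.
rewrite -rE; apply/ltW/(bmetric_triangle_lt bm (short n N n0n (leqnn N))).
have -> : (n + m = N + (n + (m - N)))%N by lia.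
rewrite (iterD N) addnC iterD; apply: N'P => //; apply: IH.
by rewrite ltn_subrL (leq_ltn_trans _ Nm).
Qed.

Theorem uniform_contraction_fixed : bcomplete d ->
  exists x, f x = x /\ forall y, bconverges d (fun n => iter n f y) x.
Proof.
move=> cd; have [y0 _] := bmetric_nonempty bm.
have [x yx] := cd _ (@uniform_contraction_cauchy y0).
have fx : f x = x.
  apply: (@bconverges_unique _ _ _ _ bm (fun n => iter n.+1 f y0)).
    apply/(bconvergesP bm) => e; move/(bconvergesP bm): yx => yx /yx[N yN].
    exists N => n Nn; apply: le_lt_trans (yN n Nn).
    by rewrite iterS; exact: uniform_contraction_le.
  exact: (bconverges_subseq bm (phi := S)) yx.
exists x; split=> // y; apply/(bconvergesP bm) => e e0.
have [N NP] := uniform_contraction_iter_small (d y x) e0.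
exists N => n Nn; have <- : iter n f x = x by elim: n {Nn} => //= n ->.
exact: NP.
Qed.

End FixedPoint.

(** * The class of functions F *)

Section Digamma.
Set Implicit Arguments.
Unset Strict Implicit.
Context {R : realType}.
Implicit Types F G : R -> R.

Lemma digamma_lt_cancel F s t : digamma_class F -> 0 < t -> F s < F t -> s < t.
Proof.
move=> dF t0 Fst; rewrite ltNge; apply/negP; rewrite le_eqVlt => /orP[/eqP ts|ts].
  by rewrite ts ltxx in Fst.
by have := lt_trans Fst (digamma_increasing dF t0 ts); rewrite ltxx.
Qed.

Lemma digamma_le F s t : digamma_class F -> 0 < s -> s <= t -> F s <= F t.
Proof.
move=> dF s0; rewrite le_eqVlt => /orP[/eqP ->//|st].
exact/ltW/(digamma_increasing dF).
Qed.

Lemma digamma_continuousP F : {within `]0, +oo[%classic, continuous F} <->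
  forall t : R, 0 < t -> F @ t --> F t.
Proof.
rewrite continuous_open_subspace; last exact: interval_open.
split=> cF t; first by move=> t0; apply: cF; rewrite inE /= in_itv /= t0.
by rewrite inE /= in_itv /= andbT => /cF.
Qed.

Lemma digamma_near F t e : digamma_class F -> 0 < t -> 0 < e ->
  exists2 r : R, 0 < r < t & forall s, `|s - t| <= r -> `|F s - F t| < e.
Proof.
move=> [/digamma_continuousP cF _ _ _] t0 e0.
have /cvgrPdist_lt/(_ e e0)/nbhs_ballP[r /= r0 rP] := cF t t0.
exists (Num.min (r / 2) (t / 2)).
  by rewrite lt_min !divr_gt0 //= gt_min; apply/orP; right; lra.
move=> s; rewrite le_min => /andP[sr _]; rewrite distrC; apply: rP.
by rewrite /ball /= distrC; lra.
Qed.

Lemma digamma_ninfty F M : digamma_class F ->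
  exists2 r : R, 0 < r & forall t, 0 < t -> t < r -> F t < M.
Proof.
move=> dF; pose a n : R := n.+1%:R^-1.
have a0 n : 0 < a n by rewrite invr_gt0.
have : (fun n => F (a n)) @ \oo --> -oo.
  apply/(digamma_lim dF a0); apply/cvgrPdist_lt => e e0.
  have [N NP] := natSinv_lt e0; exists N => // n /NP.
  by rewrite sub0r normrN gtr0_norm // a0.
move=> /cvgrNyPlt/(_ M)[N _ /(_ N (leqnn N)) aM].
by exists (a N) => // t t0 ta; apply: lt_trans aM; exact: (digamma_increasing dF).
Qed.

(** For increasing functions, (F2) is divergence to minus infinity at 0. *)
Lemma ninfty_digamma_lim F : (forall s t : R, 0 < s -> s < t -> F s < F t) ->
  (forall M, exists2 r : R, 0 < r & forall t, 0 < t -> t < r -> F t < M) ->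
  forall a : nat -> R, (forall n, 0 < a n) ->
    (a @ \oo --> (0 : R)) <-> ((fun n => F (a n)) @ \oo --> -oo).
Proof.
move=> iF nF a a0; split.
- move=> /cvgrPdist_lt ca; apply/cvgrNyPlt => M; have [r r0 rP] := nF M.
  have [N _ NP] := ca r r0; exists N => // n /NP /=.
  by rewrite sub0r normrN gtr0_norm // => /rP; apply.
- move=> /cvgrNyPlt cF; apply/cvgrPdist_lt => e e0.
  have [N _ NP] := cF (F e); exists N => // n /NP /= Fae.
  rewrite sub0r normrN gtr0_norm // ltNge; apply/negP; rewrite le_eqVlt.
  move=> /orP[/eqP ea|ea]; first by rewrite -ea ltxx in Fae.
  by have := lt_trans Fae (iF _ _ e0 ea); rewrite ltxx.
Qed.

(** The exponent in (F3) can be increased, so that two functions share one. *)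
Lemma digamma_power_le F (h h' : R) : h <= h' ->
  (fun a => a `^ h * F a) @ (0 : R)^'+ --> (0 : R) ->
  (fun a => a `^ h' * F a) @ (0 : R)^'+ --> (0 : R).
Proof.
move=> hh /cvgrPdist_lt cF; apply/cvgrPdist_lt => e e0; near=> a.
have a0 : 0 < a by near: a; exact: nbhs_right_gt.
have a1 : a <= 1 by near: a; apply: nbhs_right_le.
have : `|0 - a `^ h * F a| < e by near: a; exact: cF.
rewrite !sub0r !normrN !normrM; apply: le_lt_trans; apply: ler_wpM2r => //.
rewrite !ger0_norm ?powR_ge0 //.
by apply: ger_powR => //; rewrite a0 a1.
Unshelve. all: by end_near. Qed.

Lemma digammaD F G : digamma_class F -> digamma_class G ->
  digamma_class (fun t => F t + G t).
Proof.
move=> dF dG.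
have iFG (s t : R) : 0 < s -> s < t -> F s + G s < F t + G t.
  by move=> s0 st; apply: ltrD; apply: digamma_increasing st.
split=> //.
- apply/digamma_continuousP => t t0; apply: cvgD.
  + exact: (digamma_continuousP F).1 (digamma_continuous dF) t t0.
  + exact: (digamma_continuousP G).1 (digamma_continuous dG) t t0.
- apply: (@ninfty_digamma_lim (fun t => F t + G t)) => // M.
  have [r r0 rP] := digamma_ninfty (M - G 1) dF.
  exists (Num.min r 1); first by rewrite lt_min r0 ltr01.
  move=> t t0; rewrite lt_min => /andP[/(rP t t0) Ft t1].
  by have := digamma_increasing dG t0 t1; lra.
- have [h [/andP[h0 h1] hP]] := digamma_power dF.
  have [g [/andP[g0 g1] gP]] := digamma_power dG.
  exists (Num.max h g); split; first by rewrite lt_max h0 gt_max h1 g1.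
  have hm : h <= Num.max h g by rewrite le_max lexx.
  have gm : g <= Num.max h g by rewrite le_max lexx orbT.
  under eq_fun do rewrite mulrDr.
  have := cvgD (digamma_power_le hm hP) (digamma_power_le gm gP); rewrite addr0; apply.
Qed.

Lemma digamma_sum k (F : 'I_k -> R -> R) : (0 < k)%N ->
  (forall i, digamma_class (F i)) -> digamma_class (fun t => \sum_i F i t).
Proof.
case: k F => // k F _; elim: k F => [|k IH] F dF.
  by under eq_fun do rewrite big_ord1.
under eq_fun do rewrite big_ord_recl.
by apply: digammaD => //; apply: IH => i.
Qed.

End Digamma.

(** * Positive lower bounds for the gaps of F *)

Section Gap.
Set Implicit Arguments.
Unset Strict Implicit.
Context {R : realType}.
Implicit Types (F tau : R -> R) (P : R -> R -> Prop).

(** Near every [t0 >= 0], the gaps [F t - F h] over the positive pairs [(t, h)]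
    related by [P] with [t] close to [t0] have a positive lower bound. A single [e]
    serves as the radius and as the bound. The case [t0 = 0] is included. *)
Definition F_gap F P : Prop := forall t0, 0 <= t0 -> exists2 e : R, 0 < e &
  forall t h, 0 < t -> 0 < h -> `|t - t0| < e -> P t h -> F h + e <= F t.

Lemma F_gap_lt F P t h : F_gap F P -> 0 < t -> 0 < h -> P t h -> F h < F t.
Proof.
move=> gF t0 h0 Pth; have [e e0 eP] := gF t (ltW t0).
by have := eP t h t0 h0 _ Pth; rewrite subrr normr0 => /(_ e0); lra.
Qed.

Lemma upsilon_F_gap F tau P : upsilon_class tau ->
  (forall t h, 0 < t -> 0 < h -> P t h -> tau t + F h <= F t) -> F_gap F P.
Proof.
move=> utau tP t0 t00.
have [c c0 [r r0 rP]] : exists2 c : R, 0 < c & exists2 r : R, 0 < r &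
    forall s, 0 < s -> s != t0 -> `|s - t0| < r -> c <= tau s.
  have := upsilon_liminf utau t00; rewrite limf_einfE => /ereal_sup_gt[_ [V FV <-]].
  move=> V0; have [c c0 cV] : exists2 c : R, 0 < c &
      (c%:E <= ereal_inf ((fun s => (tau s)%:E) @` V))%E.
    by case: (ereal_inf _) V0 => [c|_|//]; [exists c|exists 1 => //; rewrite leey].
  exists c => //; move: FV => /nbhs_ballP[r /= r0 rV]; exists r => // s s0 st sr.
  have Vs : V s by apply: rV => //; rewrite /ball /= distrC.
  by rewrite -lee_fin; apply: le_trans cV _; apply: ereal_inf_lbound; exists s.
have [c' c'0 c'P] : exists2 c' : R, 0 < c' & 0 < t0 -> c' <= tau t0.
  have [t0p|t0n] := ltP 0 t0; first by exists (tau t0) => //; exact: upsilon_gt0.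
  by exists 1 => //; rewrite ltNge t0n.
exists (Num.min c (Num.min c' r)); first by rewrite !lt_min c0 c'0.
move=> t h tp hp; rewrite !lt_min => /and3P[_ _ tr] Pth.
apply: le_trans (tP t h tp hp Pth); rewrite addrC lerD2r !ge_min.
have [tt0|tt0] := eqVneq t t0; last by rewrite rP.
by rewrite tt0 c'P -?tt0 ?orbT.
Qed.

(** The witness is the infimum of 1 and all the gaps at [t]; the 1 keeps it
    meaningful where there are no pairs. *)
Lemma F_gap_upsilon F P : F_gap F P -> exists2 tau, upsilon_class tau &
  forall t h, 0 < t -> 0 < h -> P t h -> tau t + F h <= F t.
Proof.
move=> gF.
pose S t := [set 1] `|` [set F t - F h | h in [set h | 0 < h /\ P t h]].
pose tau t := inf (S t).
have lS t c : c <= 1 -> (forall h, 0 < h -> P t h -> F h + c <= F t) -> lbound (S t) c.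
  by move=> c1 cP _ [->//|[h [h0 /(cP h h0) hP] <-]]; lra.
have tau_ge t0 : 0 <= t0 -> exists2 c : R, 0 < c &
    forall t, 0 < t -> `|t - t0| < c -> c <= tau t.
  move=> /gF[e e0 eP]; exists (Num.min 1 e); first by rewrite lt_min ltr01.
  move=> t tp; rewrite lt_min => /andP[_ te]; apply: lb_le_inf; first by exists 1; left.
  apply: lS => [|h h0 Pth]; first by rewrite ge_min lexx.
  by apply: le_trans (eP t h tp h0 te Pth); rewrite lerD2l ge_min lexx orbT.
exists tau; last first.
  move=> t h t0 h0 Pth; rewrite -lerBrDr; apply: ge_inf; last by right; exists h.
  by exists 0; apply: lS => // g g0 /(F_gap_lt gF t0 g0)/ltW; rewrite addr0; apply.
split.
- move=> t t0; have [c c0 cP] := tau_ge t (ltW t0).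
  by apply: lt_le_trans (cP t t0 _); rewrite ?subrr ?normr0.
- move=> t0 /tau_ge[c c0 cP]; rewrite limf_einfE.
  apply: (@lt_le_trans _ _ c%:E); first by rewrite lte_fin.
  pose V := [set s : R | 0 < s /\ `|s - t0| < c].
  apply: (@le_trans _ _ (ereal_inf ((fun s => (tau s)%:E) @` V))).
    by apply: le_ereal_inf_tmp => _ [s [s0 sc] <-]; rewrite lee_fin cP.
  apply: ereal_sup_ubound; exists V => //.
  apply/nbhs_ballP; exists c => //= s; rewrite /ball /= distrC => sc _ s0.
  by split.
Qed.

Lemma F_gap_bigcup k F (P : 'I_k -> R -> R -> Prop) :
  (forall i, F_gap F (P i)) -> F_gap F (fun t h => exists i, P i t h).
Proof.
move=> gF t0 t00.
have /choice[e eP] i : exists e : R, 0 < e /\ forall t h,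
    0 < t -> 0 < h -> `|t - t0| < e -> P i t h -> F h + e <= F t.
  by have [e] := gF i t0 t00; exists e.
pose m := \big[Num.min/1]_i e i.
have me i : m <= e i by rewrite /m (bigD1 i) //= ge_min lexx.
exists m; first by apply: lt_bigmin => // i _; have [] := eP i.
move=> t h tp hp tm [i Pi]; have [_ iP] := eP i.
by apply: le_trans (iP t h tp hp (lt_le_trans tm (me i)) Pi); rewrite lerD2l.
Qed.

(** The other summands can only widen the gap, because the pairs of [P] satisfy
    [h < t]. *)
Lemma F_gap_sum k (F : 'I_k -> R -> R) P i : (forall j, digamma_class (F j)) ->
  F_gap (F i) P -> F_gap (fun t => \sum_j F j t) P.
Proof.
move=> dF gF t0 /[dup] t00 /gF[e e0 eP]; exists e => // t h tp hp tt0 Pth.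
have ht : h < t.
  by apply: (digamma_lt_cancel (dF i) tp); exact: (F_gap_lt gF tp hp Pth).
rewrite (bigD1 i) //= [leRHS](bigD1 i) //= addrAC lerD ?eP //; apply: ler_sum => j _.
exact: (digamma_le (dF j) hp (ltW ht)).
Qed.

(** [(t, h)] is related when, for every small [e], some pair [(s, g)] of [P] has
    [s < t + e] and [h - e < g]; note that [s] may be much smaller than [t]. *)
Definition relax P t h : Prop := forall e : R, 0 < e < h -> exists s g,
  [/\ 0 < s, P s g, s < t + e & h - e < g].

Lemma F_gap_relax F P : digamma_class F -> F_gap F P -> F_gap F (relax P).
Proof.
move=> dF gF t0; rewrite le_eqVlt => /orP[/eqP<-|t0p].
(* Near 0, also [s] is near 0, so that [F g + c <= F s]; by continuity at [t]
   and at [h], at most [c / 4] is lost on each side. *)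
- have [c c0 cP] := gF 0 (lexx 0); exists (c / 2); first by rewrite divr_gt0.
  move=> t h tp hp; rewrite subr0 gtr0_norm // => tc Pth.
  have c40 : 0 < c / 4 by rewrite divr_gt0.
  have [r /andP[r0 _] rP] := digamma_near dF tp c40.
  have [q /andP[q0 qh] qP] := digamma_near dF hp c40.
  pose e := Num.min r (Num.min q (c / 2)).
  have [er eq ec] : [/\ e <= r, e <= q & e <= c / 2].
    by rewrite /e !ge_min !lexx ?orbT.
  have e0 : 0 < e by rewrite /e !lt_min r0 q0 divr_gt0.
  have [|s [g [sp Psg st hg]]] := Pth e; first by rewrite e0 (le_lt_trans eq).
  have gp : 0 < g by lra.
  have sc : `|s - 0| < c by rewrite subr0 gtr0_norm //; lra.
  have := cP s g sp gp sc Psg.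
  have : F s <= F (t + r) by apply: digamma_le => //; lra.
  have : `|F (t + r) - F t| < c / 4 by apply: rP; rewrite addrC addKr gtr0_norm.
  have : F (h - q) <= F g by apply: digamma_le => //; lra.
  have : `|F (h - q) - F h| < c / 4.
    by apply: qP; rewrite addrC addKr normrN gtr0_norm.
  by rewrite !ltr_norml; lra.
(* At [t0 > 0], either [s] is close to [t0] and the gap [c] of [P] applies, or
   [s <= t0 - r / 2], and then [F g < F s] lies below [F t] by at least [w], as
   [t0 - r / 4 <= t]. *)
- have [c c0 cP] := gF t0 (ltW t0p).
  have c40 : 0 < c / 4 by rewrite divr_gt0.
  have [r' /andP[r'0 r't] r'P] := digamma_near dF t0p c40.
  pose r := Num.min r' c.
  have r0 : 0 < r by rewrite lt_min r'0.
  have [rr' rc] : r <= r' /\ r <= c by rewrite !ge_min !lexx orbT.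
  pose w := F (t0 - r / 4) - F (t0 - r / 2).
  have w0 : 0 < w by rewrite subr_gt0; apply: (digamma_increasing dF); lra.
  pose v := Num.min (c / 4) (w / 2).
  have v0 : 0 < v by rewrite lt_min c40 divr_gt0.
  have [vc vw] : v <= c / 4 /\ v <= w / 2 by rewrite !ge_min !lexx orbT.
  exists (Num.min (r / 4) v); first by rewrite lt_min v0 divr_gt0.
  move=> t h tp hp; rewrite lt_min => /andP[tr _] Pth.
  have mv : Num.min (r / 4) v <= v by rewrite ge_min lexx orbT.
  suff : F h + v <= F t by lra.
  have [q /andP[q0 qh] qP] := digamma_near dF hp v0.
  pose e := Num.min q (r / 4).
  have [eq er] : e <= q /\ e <= r / 4 by rewrite !ge_min !lexx orbT.
  have e0 : 0 < e by rewrite lt_min q0 divr_gt0.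
  have [|s [g [sp Psg st hg]]] := Pth e; first by rewrite e0 (le_lt_trans eq).
  have gp : 0 < g by lra.
  have : F (h - q) <= F g by apply: digamma_le => //; lra.
  have : `|F (h - q) - F h| < v by apply: qP; rewrite addrC addKr normrN gtr0_norm.
  move: tr; rewrite !ltr_norml => tr hq qg.
  have [sr|sr] := ltP (t0 - r / 2) s.
  + have sr' : `|s - t0| < r by rewrite ltr_norml; lra.
    have := cP s g sp gp (lt_le_trans sr' rc) Psg.
    have : `|F s - F t0| < c / 4 by apply: r'P; apply: le_trans (ltW sr') rr'.
    have : `|F t - F t0| < c / 4 by apply: r'P; rewrite ler_norml; lra.
    by rewrite !ltr_norml; lra.
  + have := F_gap_lt gF sp gp Psg.
    have : F s <= F (t0 - r / 2) by apply: digamma_le.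
    have : F (t0 - r / 4) <= F t by apply: digamma_le => //; lra.
    by rewrite -/w; move: (vw); rewrite /w; lra.
Qed.

(** A gap at the distances realised by [f] makes [f] a uniform contraction. *)
Lemma F_gap_uniform_contraction (Y : Type) (d : Y -> Y -> R) (f : Y -> Y) F :
  digamma_class F ->
  F_gap F (fun t h => exists x y, d x y <= t /\ h = d (f x) (f y)) ->
  uniform_contraction d f.
Proof.
move=> dF gF t0 t0p; have [e e0 eP] := gF t0 (ltW t0p).
have e20 : 0 < e / 2 by rewrite divr_gt0.
have [r /andP[r0 rt] rP] := digamma_near dF t0p e20.
pose m := Num.min r e / 2.
have [mr me] : m <= r / 2 /\ m <= e / 2.
  by rewrite !ler_pM2r ?invr_gt0 // !ge_min !lexx orbT.
have m0 : 0 < m by rewrite divr_gt0 // lt_min r0.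
exists m => // x y xy; have [fn|fp] := leP (d (f x) (f y)) 0; first by lra.
have tm : 0 < t0 + m by lra.
have te : `|t0 + m - t0| < e by rewrite addrC addKr gtr0_norm //; lra.
have := eP _ _ tm fp te (ex_intro _ x (ex_intro _ y (conj (ltW xy) erefl))).
have : `|F (t0 + m) - F t0| < e / 2 by apply: rP; rewrite addrC addKr gtr0_norm //; lra.
have : `|F (t0 - m) - F t0| < e / 2.
  by apply: rP; rewrite addrC addKr normrN gtr0_norm //; lra.
rewrite !ltr_norml => Fm Fp Fe; apply: ltW; apply: digamma_lt_cancel dF _ _; lra.
Qed.

End Gap.

(** * The Hutchinson operator *)

Section Hutchinson.
Set Implicit Arguments.
Unset Strict Implicit.
Context {R : realType} {X : Type} {b : R} {d : X -> X -> R}.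
Context (bm : is_bmetric b d).

Let d_ge0 := bmetric_ge0 bm.

Lemma dist_image_gt0 (f : X -> X) x y : 0 < d (f x) (f y) -> 0 < d x y.
Proof.
move=> fxy; apply: (bmetric_gt0 bm) => xy.
by rewrite xy (bmetric_xx bm) ltxx in fxy.
Qed.

Lemma generalized_F_contraction_le f x y :
  generalized_F_contraction d f -> d (f x) (f y) <= d x y.
Proof.
move=> [F [tau [dF utau ftau]]]; have [f0|fp] := leP (d (f x) (f y)) 0.
  exact: le_trans f0 (d_ge0 x y).
have dp := dist_image_gt0 fp; apply/ltW/(digamma_lt_cancel dF dp).
by have := ftau x y fp; have := upsilon_gt0 utau dp; lra.
Qed.

Context {k : nat} {f : 'I_k -> X -> X}.

(** The union of the images of [A] under the maps [f i]. *)
Definition hutchinson_set (A : set X) : set X := \bigcup_(i in [set: 'I_k]) (f i @` A).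

Lemma hutchinson_neq0 (A : set X) : (0 < k)%N -> A !=set0 -> hutchinson_set A !=set0.
Proof. by move=> k0 [x Ax]; exists (f (Ordinal k0) x), (Ordinal k0) => //; exists x. Qed.

(** A sequence with finitely many values is constant along a subsequence. *)
Lemma ordinal_pigeonhole (i : nat -> 'I_k) :
  exists (j : 'I_k) (phi : nat -> nat),
    {homo phi : m n / (m < n)%N} /\ forall n, i (phi n) = j.
Proof.
have [j jP] : exists j, forall N, exists2 n, (N <= n)%N & i n = j.
  apply: contrapT => nj.
  have /choice[N NP] j : exists N, forall n, (N <= n)%N -> i n <> j.
    apply: contrapT => nN; apply: nj; exists j => N; apply: contrapT => nn.
    by apply: nN; exists N => n Nn ij; apply: nn; exists n.
  pose M := \max_j N j; apply: (NP (i M) M) => //; exact: leq_bigmax.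
have /choice[next nextP] N : exists n, (N <= n)%N /\ i n = j.
  by have [n] := jP N; exists n.
pose phi := fix phi n := if n is n'.+1 then next (phi n').+1 else next 0%N.
exists j, phi; split; last first.
  by case=> [|n]; [exact: (nextP 0%N).2|exact: (nextP (phi n).+1).2].
apply: homo_ltn; first exact: ltn_trans.
by move=> n; exact: (nextP (phi n).+1).1.
Qed.

Lemma hutchinson_compact (A : set X) : (forall i x y, d (f i x) (f i y) <= d x y) ->
  bcompact d A -> bcompact d (hutchinson_set A).
Proof.
move=> fle cA u uA.
have /choice[p pP] n : exists p : 'I_k * X, A p.2 /\ f p.1 p.2 = u n.
  by have [i _ [x Ax fx]] := uA n; exists (i, x).
have [|phi [hphi [x [Ax px]]]] := cA (snd \o p); first by move=> n; have [] := pP n.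
have [j [psi [hpsi jP]]] := ordinal_pigeonhole (fst \o p \o phi).
exists (phi \o psi); split; first by move=> m n mn; apply/hphi/hpsi.
exists (f j x); split; first by exists j => //; exists x.
apply/(bconvergesP bm) => e; move/(bconvergesP bm): (bconverges_subseq bm hpsi px).
move=> /[apply] -[N NP]; exists N => n /NP; apply: le_lt_trans.
by rewrite /= -(pP _).2 (jP n : (p (phi (psi n))).1 = j).
Qed.

(** Distances between images of compact sets are reached, up to any error,
    by images under one of the maps of points that are hardly farther apart
    than the sets. *)
Lemma hutchinson_relax (A B : hyperspace d) t :
  (forall i x y, d (f i x) (f i y) <= d x y) -> (0 < k)%N -> hausdorff d A B <= t ->
  relax (fun t h => exists i x y, t = d x y /\ h = d (f i x) (f i y)) t
    (hausdorff d (hutchinson_set A) (hutchinson_set B)).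
Proof.
move=> fle k0 AB e; set h := hausdorff d (hutchinson_set _) _ => /andP[e0 eh].
have hn0 := @hyperset_neq0 _ _ d; have hc := @hyperset_compact _ _ d.
apply: contrapT => nP.
have side (C D : hyperspace d) x : hausdorff d C D <= t -> hutchinson_set C x ->
    exists2 y, hutchinson_set D y & d x y <= h - e.
  move=> CD [i _ [a Ca <-]].
  have CDe : hausdorff d C D < t + e by apply: le_lt_trans CD _; rewrite ltrDl.
  have [c Dc ac] := hausdorff_lt bm (hc C) (hn0 D) CDe Ca.
  exists (f i c); first by exists i => //; exists c.
  rewrite leNgt; apply/negP => hf; apply: nP.
  exists (d a c), (d (f i a) (f i c)); split=> //; last by exists i, a, c.
  by apply: (@dist_image_gt0 (f i)); apply: le_lt_trans hf; rewrite subr_ge0 ltW.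
suff : h <= h - e by lra.
have HA := hutchinson_neq0 k0 (hn0 A); have HB := hutchinson_neq0 k0 (hn0 B).
apply: (hausdorff_le bm HA HB) => [x|y]; first exact: side.
by apply: side; rewrite hausdorffC.
Qed.

End Hutchinson.

Theorem theorem2p1 (R : realType) (X : Type) (b : R) (d : X -> X -> R)
    (k : nat) (f : 'I_k -> X -> X)
    (IFS : generalized_F_contractive_IFS b d f) :
  exists T : hyperspace d -> hyperspace d,
    [/\ ciric_generalized_F_hutchinson b f T,
        exists! U : hyperspace d,
          T U = U /\ U = \bigcup_(i in [set: 'I_k]) (f i @` U) :> set X &
        forall A0 : hyperspace d, exists U : hyperspace d,
          T U = U /\
          (fun n : nat => hausdorff d (iter n T A0) U) @ \oo --> (0 : R)].
Proof.
have [bm cd k0 fC] := IFS.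
have fle i x y : d (f i x) (f i y) <= d x y.
  exact: (generalized_F_contraction_le bm).
pose T (A : hyperspace d) := Hyperspace
  (hutchinson_neq0 k0 (hyperset_neq0 A) : hutchinson_set (f := f) A !=set0)
  (hutchinson_compact bm fle (@hyperset_compact _ _ _ A)).
have hbm := hausdorff_bmetric bm.
pose P i t h := exists x y, t = d x y /\ h = d (f i x) (f i y).
have /choice[F FP] i : exists F, digamma_class F /\ F_gap F (P i).
  have [F [tau [dF utau ftau]]] := fC i; exists F; split=> //.
  apply: (upsilon_F_gap utau) => t h _ hp [x [y [-> hE]]].
  by rewrite hE in hp *; exact: ftau.
pose G t := \sum_i F i t.
have dF i : digamma_class (F i) by have [] := FP i.
have dG : digamma_class G by exact: digamma_sum.
have gG : F_gap G (relax (fun t h => exists i, P i t h)).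
  apply: F_gap_relax dG (F_gap_bigcup _) => i.
  by apply: (F_gap_sum (i := i)) => //; have [] := FP i.
have TU (A B : hyperspace d) t : hausdorff d A B <= t ->
    relax (fun t h => exists i, P i t h) t (hausdorff d (T A) (T B)).
  exact: (hutchinson_relax bm).
have [U [TU' cU]] : exists U, T U = U /\
    forall A, bconverges (fun A B : hyperspace d => hausdorff d A B)
      (fun n => iter n T A) U.
  apply: (uniform_contraction_fixed hbm) (hausdorff_complete bm cd).
  apply: F_gap_uniform_contraction dG _ => t0 /gG[e e0 eP].
  exists e => // t h tp hp te [A [B [AB hE]]].
  by apply: eP => //; rewrite hE; exact: TU.
exists T; split.
- split=> //; exists G; have [tau utau tauP] := F_gap_upsilon gG.
  exists tau; split=> // A B HT0.
  have HT : 0 < hausdorff d (T A) (T B).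
    by rewrite lt_neqAle eq_sym HT0 (bmetric_ge0 hbm).
  have HM : hausdorff d A B <= ciric_M b T A B by rewrite /ciric_M le_max lexx.
  apply: tauP => //; last exact: TU.
  by apply: lt_le_trans HM; exact: (dist_image_gt0 hbm) HT.
- exists U; split; first by split=> //; rewrite -[LHS](congr1 _ TU').
  move=> V [TV _]; apply: (bconverges_unique hbm (cU V)).
  apply/(bconvergesP hbm) => e e0; exists 0%N => n _.
  have -> : iter n T V = V by elim: n => //= n ->.
  by rewrite (bmetric_xx hbm).
- by move=> A0; exists U; split=> //; exact: cU.
Qed.
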